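(* Let $n\ge 3$ be an integer, let $\underline{k}=(k_1,\dots,k_n)$ be an $n$-tuple of integers with $k_i>1$ for every $i$, and let $\underline{h}=(h_1,\dots,h_n)$ be an $n$-tuple of integers with $0<h_i<k_i$ for every $i$. Then the complexities of the graphs $CS^n$ satisfy $$c(CS^n(\underline k;\underline h))=k_n\, c\big(CS^{n-1}((k_1,\dots,k_{n-1});(h_1,\dots,h_{n-1}))\big)-c\big(CS^{n-2}((k_1,\dots,k_{n-2});(h_1,\dots,h_{n-2}))\big).$$
   Context: Graphs are finite, and multiple edges are allowed. The complexity $c(\Gamma)$ of a graph $\Gamma$ is the number of spanning trees of $\Gamma$ (subgraphs that are trees and contain all the vertices of $\Gamma$; parallel edges are distinguished). The graphs $CS^n(\underline k;\underline h)$: for each $j$, let $\mathcal C_{k_j}$ be a cycle with $k_j$ vertices $v^j_1,\dots,v^j_{k_j}$ in cyclic order and $k_j$ edges $v^j_1v^j_2,\ v^j_2v^j_3,\dots,v^j_{k_j-1}v^j_{k_j},\ v^j_{k_j}v^j_1$ (for $k_j=2$ these are two distinct parallel edges $v^j_1v^j_2$ and $v^j_2v^j_1$). The graph is defined inductively. $CS^1(k_1;h_1)=\mathcal C_{k_1}$. For $n\ge 2$, $CS^n(\underline k;\underline h)$ is obtained from the disjoint union of $CS^{n-1}((k_1,\dots,k_{n-1});(h_1,\dots,h_{n-1}))$ and $\mathcal C_{k_n}$ by identifying the vertex $v^n_1$ with $v^{n-1}_{h_{n-1}}$, the vertex $v^n_{k_n}$ with $v^{n-1}_{h_{n-1}+1}$,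 and the edge $v^n_{k_n}v^n_1$ with the edge $v^{n-1}_{h_{n-1}}v^{n-1}_{h_{n-1}+1}$ of the cycle $\mathcal C_{k_{n-1}}$. So the graph is a chain of polygons in which each polygon and the following one are glued along exactly one edge. *)

(* Defs.v *)
From mathcomp Require Import all_boot.

Set Implicit Arguments.
Unset Strict Implicit.
Unset Printing Implicit Defensive.

(* Finite multigraphs.  Edges form a type of their own, so parallel edges are
   distinguished.  The order of the two components of [ends e] carries no
   meaning: everything below goes through [joins], which is symmetric. *)
Record mgraph := MGraph {
  vertex : finType;
  edge : finType;
  ends : edge -> vertex * vertex
}.

Definition joins (G : mgraph) (e : edge G) (x y : vertex G) : bool :=
  (ends e == (x, y)) || (ends e == (y, x)).

(* A subgraph containing all the vertices of [G] is given by its edge set [T]. *)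
Section SpanningTrees.
Variable G : mgraph.
Implicit Type T : {set edge G}.

Definition adj T : rel (vertex G) :=
  fun x y => [exists e in T, joins e x y].

Definition connected T : bool := [forall x, forall y, connect (adj T) x y].

(* A cycle of length m + 1: distinct vertices x_0, ..., x_m and distinct edges
   e_0, ..., e_m, with e_i joining x_i to x_(i + 1 mod m + 1).  Thus a loop is a
   cycle of length 1 and a pair of parallel edges one of length 2.  The bound
   m < #|vertex G| loses nothing, since the vertices are distinct. *)
Definition has_cycle T : bool :=
  [exists m : 'I_#|vertex G|,
   exists x : {ffun 'I_m.+1 -> vertex G}, exists e : {ffun 'I_m.+1 -> edge G},
   [&& injectiveb x, injectiveb e &
       [forall i, (e i \in T) && joins (e i) (x i) (x (ordS i))]]].

Definition spanning_tree T : bool := connected T && ~~ has_cycle T.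

End SpanningTrees.

Definition complexity (G : mgraph) : nat :=
  #|[set T : {set edge G} | spanning_tree T]|.

(* The cycle with k vertices and k edges.  Vertex and edge types are
   'I_(k.-1.+1), i.e. 'I_k for k > 0 (the value at k = 0 is irrelevant). *)
Definition polygon (k : nat) : mgraph :=
  @MGraph 'I_k.-1.+1 'I_k.-1.+1 (fun i => (i, ordS i)).

(* 1-based numbering: v_1, ..., v_k, and the edges e_i = v_i v_(i+1) for
   0 < i < k, e_k = v_k v_1. *)
Definition polygon_vertex (k i : nat) : vertex (polygon k) := inord i.-1.
Definition polygon_edge (k i : nat) : edge (polygon k) := inord i.-1.

(* The quotient of the disjoint union of [G] and [H] by c ~ a, d ~ b (vertices)
   and f ~ e (edges).  Each class is represented by its element of [G] if it has
   one, and otherwise by its unique element of [H]; so [e] only enters through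
   [glue_edge], the image of an edge of [H] in the quotient.  The lemmas of this section
   check that this is that quotient: [inl] is injective, [glue_vertex] and
   [glue_edge] identify exactly what they should, and ends are preserved. *)
Section Glue.
Variables (G H : mgraph) (a b : vertex G) (e : edge G).
Variables (c d : vertex H) (f : edge H).

Definition glue_V : finType := (vertex G + {v | v \notin [:: c; d]})%type.
Definition glue_E : finType := (edge G + {g | g != f})%type.

Definition glue_vertex (v : vertex H) : glue_V :=
  if insub v is Some w then inr w else inl (if v == c then a else b).

Definition glue_edge (g : edge H) : glue_E :=
  if insub g is Some g' then inr g' else inl e.

Definition glue_ends (g : glue_E) : glue_V * glue_V :=
  match g with
  | inl g => (inl (ends g).1, inl (ends g).2)
  | inr g => (glue_vertex (ends (val g)).1, glue_vertex (ends (val g)).2)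
  end.

Definition glue : mgraph := MGraph glue_ends.

Lemma glue_vertex_surj (x : vertex glue) :
  (exists u, x = inl u) \/ (exists v, x = glue_vertex v).
Proof.
case: x => [u|w]; [by left; exists u | right; exists (val w)].
by rewrite /glue_vertex valK.
Qed.

Lemma glue_edge_surj (x : edge glue) :
  (exists g, x = inl g) \/ (exists g, x = glue_edge g).
Proof.
case: x => [g|w]; [by left; exists g | right; exists (val w)].
by rewrite /glue_edge valK.
Qed.

Lemma glue_vertexP (u : vertex G) (v : vertex H) : c != d ->
  glue_vertex v = inl u <-> (v = c /\ u = a) \/ (v = d /\ u = b).
Proof.
move=> cd; rewrite /glue_vertex; case: insubP => [w|]; rewrite !inE.
  by move=> vN _; split=> // -[] [vE _]; move: vN; rewrite vE eqxx ?orbT.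
rewrite negbK; case: (eqVneq v c) => [-> _|vc /= /eqP ->]; split.
- by case=> ->; left.
- by case=> -[] => [_ ->|cE] //; rewrite cE eqxx in cd.
- by case=> ->; right.
- by case=> -[] => [dE|_ ->] //; rewrite dE eqxx in cd.
Qed.

Lemma glue_vertex_inj : a != b -> c != d -> injective glue_vertex.
Proof.
move=> ab cd v w; rewrite {2}/glue_vertex; case: insubP => [w' _ <-|].
  by rewrite /glue_vertex; case: insubP => // v' _ <- [->].
rewrite !inE negbK; case: (eqVneq w c) => [-> _|_ /= /eqP ->].
  by case/(glue_vertexP _ _ cd) => -[-> // abE]; rewrite abE eqxx in ab.
by case/(glue_vertexP _ _ cd) => -[-> // abE]; rewrite abE eqxx in ab.
Qed.

Lemma glue_edgeP (g : edge G) (g' : edge H) :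
  glue_edge g' = inl g <-> g' = f /\ g = e.
Proof.
rewrite /glue_edge; case: insubP => [w|]; first by move=> /eqP fN _; split=> // -[].
by rewrite negbK => /eqP ->; split=> [[->]|[_ ->]].
Qed.

Lemma glue_edge_inj : injective glue_edge.
Proof.
move=> g g'; rewrite {2}/glue_edge; case: insubP => [w _ <-|].
  by rewrite /glue_edge; case: insubP => // w' _ <- [->].
by rewrite negbK => /eqP -> /glue_edgeP[].
Qed.

Lemma glue_joins_inl (g : edge G) x y :
  joins g x y -> @joins glue (inl g) (inl x) (inl y).
Proof. by rewrite /joins /= => /orP[] /eqP ->; rewrite eqxx ?orbT. Qed.

Lemma glue_joins_edge (g : edge H) x y :
  c != d -> joins e a b -> joins f d c -> joins g x y ->
  @joins glue (glue_edge g) (glue_vertex x) (glue_vertex y).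
Proof.
move=> cd eab fdc gxy; rewrite {1}/glue_edge; case: insubP => [w _ gE|].
  by move: gxy; rewrite /joins /= gE => /orP[] /eqP ->; rewrite eqxx ?orbT.
rewrite negbK => /eqP gE; have Ec : glue_vertex c = inl a.
  by apply/glue_vertexP => //; left.
have Ed : glue_vertex d = inl b by apply/glue_vertexP => //; right.
have := glue_joins_inl eab; rewrite /joins; move: gxy fdc.
rewrite gE /joins => /orP[] /eqP -> /orP[] /eqP[] -> ->;
  by rewrite Ec Ed // orbC.
Qed.

End Glue.

(* A graph together with the vertices v^n_i and the edges e^n_i of the last
   polygon of the chain (1-based as above). *)
Record chain := Chain {
  chain_graph :> mgraph;
  last_vertex : nat -> vertex chain_graph;
  last_edge : nat -> edge chain_graph
}.

Definition polygon_chain (k : nat) : chain :=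
  @Chain (polygon k) (polygon_vertex k) (polygon_edge k).

(* v_1 is identified with v^n_h, v_k with v^n_(h+1), and v_k v_1 with
   v^n_h v^n_(h+1). *)
Definition glue_polygon (C : chain) (h k : nat) : chain :=
  let a := last_vertex C h in
  let b := last_vertex C h.+1 in
  let e := last_edge C h in
  let c := polygon_vertex k 1 in
  let d := polygon_vertex k k in
  let f := polygon_edge k k in
  @Chain (glue a b c d f)
    (fun i => glue_vertex a b c d (polygon_vertex k i))
    (fun i => glue_edge e f (polygon_edge k i)).

(* The first m + 1 polygons; lists are 0-based, so k_j is [nth 0 k j.-1]. *)
Fixpoint CS_chain (k h : seq nat) (m : nat) : chain :=
  if m is m'.+1 then
    glue_polygon (CS_chain k h m') (nth 0 h m') (nth 0 k m)
  else polygon_chain (nth 0 k 0).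

(* CS^n(k; h) with n = size k. *)
Definition CS (k h : seq nat) : mgraph := CS_chain k h (size k).-1.

(* Main.v *)
Require Import Defs.
From mathcomp Require Import all_boot all_algebra.
From mathcomp Require Import zify.

Set Implicit Arguments.
Unset Strict Implicit.
Unset Printing Implicit Defensive.

(** Gluing a k-gon along an edge e = ab adds a path of k - 1 new edges, the
    sides, from a to b, in parallel with e.  A spanning tree of the new graph
    G' misses at most one side, since otherwise a piece of the path would hang
    loose.
    - If it misses exactly one side, the two remaining pieces of the path are
      dangling branches, and the rest is an arbitrary spanning tree of G.
    - If it misses none, the path does the work of e: the rest T avoids e, and
      T with e added is a spanning tree of G.
    So c(G') = (k - 1) c(G) + #{trees of G with e}, that is,
      c(G') + #{trees of G without e} = k c(G)          ([complexity_glue]).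
    A spanning tree of G' avoiding a given side misses just that side, so
      #{trees of G' without that side} = c(G)           ([trees_without_side]).
    In the chain, the edge along which polygon n is glued is a side of polygon
    n - 1 (it is not the closing edge because h < k).  Hence the second
    identity, for the gluing of polygon n - 1, evaluates the correction term of
    the first one, for the gluing of polygon n, as c(CS^(n-2)).

    Two reformulations avoid any manipulation of paths and cycles in G'.  An
    edge set is connected iff every 2-colouring of the vertices that is
    constant along its edges is constant ([connectedP]); colourings restrict to
    G and extend from G to G' with no case analysis on paths.  And a spanning
    tree is a connected edge set from which no edge can be removed without
    disconnecting it ([spanning_tree_minimal]), so that only the connectivity
    of edge sets of G' has to be computed. *)

(** * Spanning trees as minimal connected edge sets *)

Section Colourings.
Variable G : mgraph.
Implicit Types (T : {set edge G}) (s : vertex G -> bool).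

Definition respects s T := forall g, g \in T -> s (ends g).1 = s (ends g).2.

Lemma respects_joins s T g x y :
  respects s T -> g \in T -> joins g x y -> s x = s y.
Proof. by move=> sT /sT; rewrite /joins => gE /orP[] /eqP E; rewrite E in gE. Qed.

Lemma connectedP T :
  reflect (forall s, respects s T -> forall x y, s x = s y) (connected T).
Proof.
apply: (iffP idP) => [/forallP cT s sT x y | cT].
  have /connectP[p pP ->] := forallP (cT x) y.
  elim: p x pP => //= z p IHp x /andP[/existsP[g /andP[gT gxz]] /IHp <-].
  exact: respects_joins sT gT gxz.
apply/forallP=> x; apply/forallP=> y.
(* The component of x is a colour class of a compatible colouring. *)
rewrite -(cT (fun z => connect (adj T) x z) _ x y) ?connect0 // => g gT.
have adj_g: adj T (ends g).1 (ends g).2.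
  by apply/existsP; exists g; rewrite gT /joins -surjective_pairing eqxx.
have adj_g': adj T (ends g).2 (ends g).1.
  by apply/existsP; exists g; rewrite gT /joins -surjective_pairing eqxx orbT.
by apply/idP/idP => xg; apply: connect_trans xg (connect1 _).
Qed.

(** Any edge g of a cycle can be removed: a colouring compatible with T minus g
    is constant along the rest of the cycle, hence agrees at the ends of g. *)
Lemma has_cycle_removable T :
  has_cycle T -> connected T -> exists2 g, g \in T & connected (T :\ g).
Proof.
case/existsP=> m /existsP[x /existsP[e /and3P[_ /injectiveP e_inj /forallP xeP]]].
move=> /connectedP cT; exists (e ord_max); first by case/andP: (xeP ord_max).
apply/connectedP=> s sT; apply: cT => g gT.
have [gE|gN] := eqVneq g (e ord_max); last by apply: sT; rewrite !inE gN.
have sx i (im : i < m.+1) : s (x ord0) = s (x (Ordinal im)).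
  elim: i im => [|i IHi] im; first by congr (s (x _)); apply: val_inj.
  have im' : i < m.+1 by lia.
  rewrite (IHi im'); have /andP[eT ei] := xeP (Ordinal im').
  have -> : Ordinal im = ordS (Ordinal im').
    by apply: val_inj; rewrite /= modn_small.
  apply: respects_joins sT _ ei; rewrite !inE eT andbT.
  by apply/negP=> /eqP /e_inj /(congr1 val) /= iE; rewrite iE ltnn in im.
have /andP[_] := xeP ord_max; rewrite -gE.
have -> : ordS ord_max = ord0 :> 'I_m.+1 by apply: val_inj; rewrite /= modnn.
have := sx m (ltnSn m); have -> : Ordinal (ltnSn m) = ord_max by apply: val_inj.
by rewrite /joins => s0m /orP[] /eqP ->.
Qed.

(** If T minus g is connected, a simple path in it between the ends of g closes
    up with g to a cycle.  For a loop g the path is empty. *)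
Lemma removable_has_cycle T g :
  g \in T -> connected (T :\ g) -> has_cycle T.
Proof.
move=> gT cT.
have /connectP[p0 p0P vE] := forallP (forallP cT (ends g).1) (ends g).2.
case/shortenP: p0P vE => p pP p_uniq _ {p0} vE.
set u := (ends g).1 in pP p_uniq vE.
have m_lt : size p < #|vertex G|.
  by rewrite -[_.+1]/(size (u :: p)) -(card_uniqP p_uniq) max_card.
pose xs i := nth u (u :: p) i.
have xs_inj i j : i <= size p -> j <= size p -> xs i = xs j -> i = j.
  by move=> ip jp /eqP; rewrite nth_uniq // => /eqP.
(* The default g of the inner choice is never reached, see esP. *)
pose es i := if i < size p
  then odflt g [pick g' in T :\ g | joins g' (xs i) (xs i.+1)] else g.
have esP i : i < size p -> es i \in T :\ g /\ joins (es i) (xs i) (xs i.+1).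
  move=> ip; rewrite /es ip; case: pickP => [g' /andP[]|none] //.
  have /existsP[g' g'P] := pathP u pP i ip.
  by have /andP[gT' gJ] := g'P; have := none g'; rewrite /= gT' gJ.
(* The vertices of the path being distinct, an edge determines its position on
   it; g itself, at the last position, is not an edge of T minus g. *)
have es_inj i j : i <= size p -> j <= size p -> es i = es j -> i = j.
  have esN l : l < size p -> es l != g.
    by case/esP => + _; rewrite !inE => /andP[].
  have esm : es (size p) = g by rewrite /es ltnn.
  rewrite leq_eqVlt => /orP[/eqP ->|ip].
    rewrite leq_eqVlt => /orP[/eqP -> //|/esN]; rewrite esm.
    by move=> /eqP ejN /esym.
  rewrite leq_eqVlt => /orP[/eqP ->|jp].
    by rewrite esm; move/esN: ip => /eqP.
  move=> eE; have [_] := esP i ip; have [_] := esP j jp; rewrite eE /joins.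
  move=> /orP[] /eqP -> /orP[] /eqP [] E1 E2.
  - by apply/esym/xs_inj => //; lia.
  - by have := xs_inj _ _ _ _ E1; have := xs_inj _ _ _ _ E2; lia.
  - by have := xs_inj _ _ _ _ E1; have := xs_inj _ _ _ _ E2; lia.
  - by apply/esym/xs_inj => //; lia.
apply/existsP; exists (Ordinal m_lt).
apply/existsP; exists [ffun i : 'I_(size p).+1 => xs i].
apply/existsP; exists [ffun i : 'I_(size p).+1 => es i].
apply/and3P; split.
- apply/injectiveP=> i j; rewrite !ffunE => /xs_inj ijE.
  by apply/val_inj/ijE; rewrite -ltnS.
- apply/injectiveP=> i j; rewrite !ffunE => /es_inj ijE.
  by apply/val_inj/ijE; rewrite -ltnS.
apply/forallP=> i; rewrite !ffunE /=.
have := ltn_ord i; rewrite /= ltnS leq_eqVlt => /orP[/eqP ->|ip].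
  rewrite /es ltnn gT modnn /joins /xs /= -last_nth -vE.
  by rewrite -surjective_pairing eqxx orbT.
rewrite modn_small //; have [] := esP i ip.
by rewrite !inE => /andP[_ ->] ->.
Qed.

Lemma spanning_tree_minimal T :
  spanning_tree T = connected T && [forall g in T, ~~ connected (T :\ g)].
Proof.
rewrite /spanning_tree; case cT: (connected T) => //=.
apply/idP/forall_inP => [acT g gT | minT].
  by apply: contra acT => /removable_has_cycle ->.
by apply/negP=> /has_cycle_removable /(_ cT)[g /minT /negP].
Qed.

Definition trees_with (g : edge G) : {set {set edge G}} :=
  [set T | spanning_tree T & g \in T].
Definition trees_without (g : edge G) : {set {set edge G}} :=
  [set T | spanning_tree T & g \notin T].

Lemma complexity_split g :
  complexity G = #|trees_with g| + #|trees_without g|.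
Proof.
rewrite /complexity -(cardsID [set T : {set edge G} | g \in T]).
by congr (_ + _); apply: eq_card => T; rewrite !inE // andbC.
Qed.

Lemma card_trees_with g :
  #|trees_with g| =
    #|[set T : {set edge G} | (g \notin T) && spanning_tree (g |: T)]|.
Proof.
rewrite -(@card_in_imset _ _ (fun T => g |: T)); last first.
  move=> T T'; rewrite !inE => /andP[gT _] /andP[gT' _] E.
  by rewrite -(setU1K gT) -(setU1K gT') E.
apply: eq_card => T; rewrite inE; apply/andP/imsetP => [[tT gT]|[T' + ->]].
  by exists (T :\ g); rewrite ?inE ?eqxx setD1K.
by rewrite !inE eqxx => /andP[].
Qed.

End Colourings.

(** * Connectivity after gluing a polygon *)

Section GluePolygon.
Variables (G : mgraph) (a b : vertex G) (e : edge G) (k : nat).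
Hypothesis k_gt1 : 1 < k.
Hypothesis eab : joins e a b.

Let c := polygon_vertex k 1.
Let d := polygon_vertex k k.
Let f := polygon_edge k k.
Let G' := glue a b c d f.
Let side := {g : edge (polygon k) | g != f}.

Implicit Types (T : {set edge G}) (M : {set side}).

Definition side_index (p : side) : nat := val p.

Lemma side_index_lt p : side_index p < k.-1.
Proof.
rewrite /side_index; case: p => g /= gf.
have gN : nat_of_ord g != k.-1.
  apply: contra gf => /eqP gE; apply/eqP/val_inj.
  by rewrite /= gE inordK //.
by move: (ltn_ord g) gN; rewrite /=; lia.
Qed.

Lemma side_index_inj : injective side_index.
Proof. by move=> p q /val_inj /val_inj. Qed.

Lemma side_at i : i < k.-1 -> {p | side_index p = i}.
Proof.
move=> ik; have iN : (inord i : edge (polygon k)) != f.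
  apply/negP=> /eqP /(congr1 val) /=; rewrite !inordK //; lia.
by exists (exist (fun g => g != f) _ iN); rewrite /side_index /= inordK //; lia.
Qed.

Lemma card_side : #|{: side}| = k.-1.
Proof. by rewrite card_sub cardC1 card_ord. Qed.

(** Positions on the path run from 0 at a to k - 1 at b. *)
Definition side_vertex (i : nat) : vertex G' :=
  glue_vertex a b c d (inord i : vertex (polygon k)).

Lemma side_vertex_first : side_vertex 0 = inl a.
Proof.
by rewrite /side_vertex /glue_vertex insubF ?eqxx // !inE eqxx.
Qed.

Lemma side_vertex_last : side_vertex k.-1 = inl b.
Proof.
rewrite /side_vertex /glue_vertex insubF ?inE ?eqxx ?orbT //.
case: eqP => // /(congr1 val) /=; rewrite !inordK //; lia.
Qed.

Lemma side_vertex_surj (x : vertex G') :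
  (exists u, x = inl u) \/ (exists2 i, i < k & x = side_vertex i).
Proof.
have [[u ->]|[v ->]] := glue_vertex_surj x; first by left; exists u.
right; exists (val v); last by rewrite /side_vertex inord_val.
by have := ltn_ord v; rewrite /=; lia.
Qed.

Lemma ends_side p :
  ends (inr p : edge G') =
    (side_vertex (side_index p), side_vertex (side_index p).+1).
Proof.
rewrite /= /side_vertex /side_index inord_val; congr (_, glue_vertex a b c d _).
apply: val_inj => /=; have := side_index_lt p; rewrite /side_index => pk.
by rewrite inordK ?modn_small.
Qed.

(** The second argument is the set of missing sides, because its cardinal is
    what decides whether the edge set can be a tree. *)
Definition glued_set T M : {set edge G'} :=
  [set x | match x with inl g => g \in T | inr p => p \notin M end].

Lemma glued_setP (T' : {set edge G'}) :
  T' = glued_set [set g | inl g \in T'] [set p | inr p \notin T'].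
Proof. by apply/setP=> -[x|x]; rewrite !inE ?negbK. Qed.

Lemma glued_set_inj T M T1 M1 :
  glued_set T M = glued_set T1 M1 -> T = T1 /\ M = M1.
Proof.
move/setP=> E; split; apply/setP=> x.
  by have := E (inl x); rewrite !inE.
by have := E (inr x); rewrite !inE => /(congr1 negb); rewrite !negbK.
Qed.

Lemma glued_setD1l T M g : glued_set T M :\ inl g = glued_set (T :\ g) M.
Proof. by apply/setP=> -[x|x]; rewrite !inE. Qed.

Lemma glued_setD1r T M p : glued_set T M :\ inr p = glued_set T (p |: M).
Proof. by apply/setP=> -[x|x]; rewrite !inE ?negb_or. Qed.

Lemma respects_glued (s : vertex G' -> bool) T M :
  respects s (glued_set T M) <->
  respects (fun u => s (inl u)) T /\
  forall p, p \notin M ->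
    s (side_vertex (side_index p)) = s (side_vertex (side_index p).+1).
Proof.
split=> [sT | [sT sM] [g|p]].
- split=> [g gT | p pM].
    by have := sT (inl g); rewrite inE; apply.
  by have := sT (inr p); rewrite inE ends_side; apply.
- by rewrite inE; apply: sT.
by rewrite inE ends_side; apply: sM.
Qed.

Definition extend (s : vertex G -> bool) (t : nat -> bool) (x : vertex G') :=
  match x with inl u => s u | inr w => t (nat_of_ord (val w)) end.

Lemma extend_side s t i : s a = t 0 -> s b = t k.-1 -> i < k ->
  extend s t (side_vertex i) = t i.
Proof.
move=> sa sb ik; have [->|i0] := eqVneq i 0; first by rewrite side_vertex_first.
have [->|ik1] := eqVneq i k.-1; first by rewrite side_vertex_last.
have iE : (inord i : 'I_k.-1.+1) = i :> nat by rewrite inordK //; lia.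
have iN : (inord i : vertex (polygon k)) \notin [:: c; d].
  rewrite !inE -!val_eqE /= !inordK //; lia.
rewrite /side_vertex /glue_vertex; case: insubP => [w _ wE|]; last by rewrite iN.
by rewrite /= wE /= iE.
Qed.

Lemma respects_extend s t T M : s a = t 0 -> s b = t k.-1 ->
  respects s T ->
  (forall p, p \notin M -> t (side_index p) = t (side_index p).+1) ->
  respects (extend s t) (glued_set T M).
Proof.
move=> sa sb sT tM; apply/respects_glued; split=> // p /tM pE.
by have := side_index_lt p => pk; rewrite !extend_side //; lia.
Qed.

Lemma eq_of_consecutive (t : nat -> bool) i j : i <= j ->
  (forall l, i <= l < j -> t l = t l.+1) -> t i = t j.
Proof.
move=> ij; rewrite -(subnKC ij); elim: (j - i) => [|n IHn] tE; first by rewrite addn0.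
by rewrite addnS -tE ?IHn //; [move=> l lE; apply: tE|]; lia.
Qed.

Lemma respects_segment (s : vertex G' -> bool) T M i j :
  respects s (glued_set T M) -> i <= j -> j < k ->
  (forall p, i <= side_index p < j -> p \notin M) ->
  s (side_vertex i) = s (side_vertex j).
Proof.
move=> /respects_glued[_ sM] ij jk ijM.
apply: (@eq_of_consecutive (fun i => s (side_vertex i)) i j ij) => l lij.
have [|p pE] := @side_at l; first lia.
by rewrite -pE; apply/sM/ijM; rewrite pE.
Qed.

Lemma respects_edge (s : vertex G -> bool) T :
  respects s (e |: T) <-> respects s T /\ s a = s b.
Proof.
split=> [sT | [sT sab] g]; last first.
  rewrite !inE => /orP[/eqP ->|]; last exact: sT.
  by move: eab; rewrite /joins => /orP[] /eqP ->.
split; last by apply: respects_joins sT _ eab; rewrite setU11.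
by move=> g gT; apply: sT; rewrite !inE gT orbT.
Qed.

(** Colourings of G' compatible with the whole path take one value on it, so
    they correspond to colourings of G that agree at a and b, which is what
    compatibility with e means. *)
Lemma connected_missing0 T :
  connected (glued_set T set0) = connected (e |: T).
Proof.
apply/connectedP/connectedP => cT s.
  case/respects_edge=> sT sab x y.
  apply: (cT (extend s (fun=> s a)) _ (inl x) (inl y)).
  exact: respects_extend.
move=> sT; have s_side i : i < k -> s (inl a) = s (side_vertex i).
  move=> ik; rewrite -side_vertex_first; apply: respects_segment sT _ _ _ => //.
  by move=> p _; rewrite inE.
have sl u : s (inl u) = s (inl a).
  apply: (cT (fun u => s (inl u))); apply/respects_edge; split.
    by have /respects_glued[] := sT.
  by rewrite -side_vertex_last -s_side //; lia.
suff sa x : s x = s (inl a) by move=> x y; rewrite !sa.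
by have [[u ->]|[i ik ->]] := side_vertex_surj x; rewrite ?sl -?s_side.
Qed.

(** With the side p missing, a colouring of G extends in exactly one way: by the
    colour of a before p and by the colour of b after p. *)
Lemma connected_missing1 T p : connected (glued_set T [set p]) = connected T.
Proof.
have pk := side_index_lt p.
apply/connectedP/connectedP => cT s sT.
  pose t i := if i <= side_index p then s a else s b.
  move=> x y; apply: (cT (extend s t) _ (inl x) (inl y)).
  apply: respects_extend => //; first by rewrite /t leqNgt pk.
  move=> q; rewrite inE => qp; rewrite /t.
  have : side_index q != side_index p by apply: contra qp => /eqP/side_index_inj->.
  by move=> qpE; case: ltngtP qpE => //; lia.
have sl u v : s (inl u) = s (inl v).
  by apply: (cT (fun u => s (inl u))); have /respects_glued[] := sT.
suff sa x : s x = s (inl a) by move=> x y; rewrite !sa.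
have [[u ->]|[i ik ->]] := side_vertex_surj x; first exact: sl.
have [ip|pi] := leqP i (side_index p).
  rewrite -side_vertex_first; apply/esym/(respects_segment sT) => // q qi.
  by rewrite inE; apply/eqP=> qp; rewrite qp in qi; lia.
rewrite (sl a b) -side_vertex_last.
apply: (respects_segment sT); [lia | lia | move=> q qi].
by rewrite inE; apply/eqP=> qp; rewrite qp in qi; lia.
Qed.

(** The stretch of the path after p and up to q is nonempty and attached to
    nothing, so it can have a colour of its own. *)
Lemma connected_missing2 T M p q :
  p \in M -> q \in M -> p != q -> ~~ connected (glued_set T M).
Proof.
wlog pq : p q / side_index p < side_index q => [wl pM qM pqN|].
  have : side_index p != side_index q by rewrite (inj_eq side_index_inj).
  by rewrite neq_ltn => /orP[] /wl; apply=> //; rewrite eq_sym.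
move=> pM qM _; apply/negP=> /connectedP cT.
have qk := side_index_lt q.
pose t i := side_index p < i <= side_index q.
have t0 : false = t 0 by [].
have tk : false = t k.-1 by rewrite /t; lia.
suff /cT /(_ (inl a) (side_vertex (side_index q))) :
    respects (extend (fun=> false) t) (glued_set T M).
  by rewrite extend_side //; [rewrite /= /t pq leqnn | lia].
apply: respects_extend => // l lM.
have lp : side_index l != side_index p.
  by apply: contraNneq lM => /side_index_inj ->.
have lq : side_index l != side_index q.
  by apply: contraNneq lM => /side_index_inj ->.
by rewrite /t; lia.
Qed.

(** Minimality on the left tests the removal of a side, which leaves
    connectivity of T; minimality on the right tests the removal of e, which
    asks for the same.  If e were already in T, T would be connected and any
    side could be removed. *)
Lemma spanning_tree_missing0 T :
  spanning_tree (glued_set T set0) = (e \notin T) && spanning_tree (e |: T).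
Proof.
rewrite !spanning_tree_minimal connected_missing0.
have [|p0 _] := @side_at 0; first lia.
have [eT|eT] /= := boolP (e \in T).
  rewrite (setUidPr _) ?sub1set //; apply/andP=> -[cT /forall_inP minT].
  have := minT (inr p0); rewrite !inE glued_setD1r setU0 connected_missing1.
  by rewrite cT => /(_ isT).
congr (_ && _); apply/forall_inP/forall_inP => minT.
  move=> g; rewrite !inE => /orP[/eqP ->|gT].
    have := minT (inr p0); rewrite !inE glued_setD1r setU0 connected_missing1.
    by rewrite setU1K //; apply.
  have ge : e != g by apply: contraNneq eT => ->.
  have := minT (inl g); rewrite inE glued_setD1l connected_missing0 => /(_ gT).
  by rewrite setDUl [[set e] :\ g](setDidPl _) // disjoints1 inE.
move=> [g|p]; rewrite inE => gT.
  have ge : e != g by apply: contraNneq eT => ->.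
  rewrite glued_setD1l connected_missing0.
  have := minT g; rewrite !inE gT orbT => /(_ isT).
  by rewrite setDUl [[set e] :\ g](setDidPl _) // disjoints1 inE.
rewrite glued_setD1r setU0 connected_missing1.
by have := minT e; rewrite setU11 setU1K //; apply.
Qed.

(** No further side can be removed by [connected_missing2], so minimality only
    concerns the edges of G. *)
Lemma spanning_tree_missing1 T p :
  spanning_tree (glued_set T [set p]) = spanning_tree T.
Proof.
rewrite !spanning_tree_minimal connected_missing1; congr (_ && _).
apply/forall_inP/forall_inP => minT.
  move=> g gT; have := minT (inl g).
  by rewrite inE glued_setD1l connected_missing1; apply.
move=> [g|q]; rewrite inE => gT.
  by rewrite glued_setD1l connected_missing1; apply: minT.
rewrite glued_setD1r; apply: (@connected_missing2 _ _ p q).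
- by rewrite !inE eqxx orbT.
- by rewrite setU11.
by rewrite inE eq_sym in gT.
Qed.

Lemma spanning_tree_gluedP (T' : {set edge G'}) : spanning_tree T' ->
  (exists2 T, T' = glued_set T set0 & (e \notin T) && spanning_tree (e |: T)) \/
  (exists T p, T' = glued_set T [set p] /\ spanning_tree T).
Proof.
rewrite (glued_setP T'); set T := [set g | _]; set M := [set p | _] => tT.
have [M0|[p pM]] := set_0Vmem M.
  by left; exists T; rewrite ?M0 // -spanning_tree_missing0 -M0.
right; exists T, p; suff ME : M = [set p].
  by rewrite -(spanning_tree_missing1 _ p) -ME.
apply/setP=> q; rewrite inE; apply/idP/eqP => [qM|-> //].
apply/eqP; apply: contraLR tT => qp; rewrite /spanning_tree negb_and.
by rewrite (connected_missing2 _ qM pM).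
Qed.

(** * Counting spanning trees *)

(** The trees with no missing side are counted by the trees of G with e, those
    with one missing side by (k - 1) c(G); adding the trees of G without e to
    the former makes it c(G). *)
Lemma complexity_glue :
  complexity G' + #|trees_without e| = k * complexity G.
Proof.
pose A0 := (fun T => glued_set T set0) @:
  [set T : {set edge G} | (e \notin T) && spanning_tree (e |: T)].
pose A1 := (fun u : {set edge G} * side => glued_set u.1 [set u.2]) @:
  setX [set T | spanning_tree T] setT.
have c0 : #|A0| = #|trees_with e|.
  by rewrite card_trees_with card_imset // => T T1 /glued_set_inj[].
have c1 : #|A1| = complexity G * k.-1.
  rewrite card_imset ?cardsX ?cardsT ?card_side //.
  by move=> [T p] [T1 p1] /glued_set_inj /= [-> /set1_inj ->].
have cE : complexity G' = #|A0 :|: A1|.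
  apply: eq_card => T'; rewrite !inE; apply/idP/orP.
    case/spanning_tree_gluedP=> [[T -> tT]|[T [p [-> tT]]]]; [left|right].
      by apply/imsetP; exists T; rewrite ?inE.
    by apply/imsetP; exists (T, p); rewrite ?inE ?tT.
  case=> /imsetP[u + ->]; rewrite !inE.
    by rewrite spanning_tree_missing0.
  by rewrite andbT spanning_tree_missing1.
have A01 : A0 :&: A1 = set0.
  apply/setP=> T'; rewrite !inE; apply/andP=> -[/imsetP[T _ ->] /imsetP[u _]].
  by case/glued_set_inj=> _ /setP/(_ u.2); rewrite !inE eqxx.
rewrite cE cardsU A01 cards0 subn0 c0 c1 addnAC -complexity_split.
by rewrite -mulnS mulnC prednK //; lia.
Qed.

Lemma trees_without_side (p : side) :
  #|trees_without (inr p : edge G')| = complexity G.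
Proof.
rewrite /complexity -(@card_imset _ _ (fun T => glued_set T [set p])); last first.
  by move=> T T1 /glued_set_inj[].
apply: eq_card => T'; rewrite inE; apply/andP/imsetP => [[]|[T]].
  case/spanning_tree_gluedP=> [[T -> tT]|[T [q [-> tT]]]]; rewrite !inE //.
  by rewrite negbK => /eqP ->; exists T; rewrite ?inE.
by rewrite inE => tT ->; rewrite spanning_tree_missing1 !inE eqxx.
Qed.

End GluePolygon.

(** * The recurrence along the chain *)

Lemma polygon_edge_side k i : 0 < i < k -> polygon_edge k i != polygon_edge k k.
Proof. by move=> ik; rewrite -val_eqE /= !inordK; lia. Qed.

Lemma glue_edge_side G H (e : edge G) (f g : edge H) (gf : g != f) :
  glue_edge e f g = inr (exist (fun g' => g' != f) g gf).
Proof. by rewrite /glue_edge insubT. Qed.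

Lemma ends_polygon_edge k i : 0 < i < k ->
  ends (polygon_edge k i) = (polygon_vertex k i, polygon_vertex k i.+1).
Proof.
move=> ik; congr (_, _); apply: val_inj => /=.
by rewrite !inordK ?modn_small; lia.
Qed.

(** The bounds on i exclude the closing edge, which goes back to the first
    vertex of the last polygon. *)
Lemma last_edge_joins k h m i : 0 < i < nth 0 k m ->
  let C := CS_chain k h m in
  joins (last_edge C i) (last_vertex C i) (last_vertex C i.+1).
Proof.
case: m => [|m] ik /=; first by rewrite /joins ends_polygon_edge ?eqxx.
rewrite (glue_edge_side _ (polygon_edge_side ik)) /joins /=.
by case: (ends_polygon_edge ik) => ->; rewrite eqxx.
Qed.

(** [complexity_glue] for the last polygon, where the edge of gluing is a side
    of the polygon before it, so that [trees_without_side] applies. *)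
Lemma CS_chain_recurrence k h m :
  1 < nth 0 k m.+1 -> 1 < nth 0 k m.+2 ->
  0 < nth 0 h m < nth 0 k m -> 0 < nth 0 h m.+1 < nth 0 k m.+1 ->
  complexity (CS_chain k h m.+2) + complexity (CS_chain k h m) =
    nth 0 k m.+2 * complexity (CS_chain k h m.+1).
Proof.
move=> k1 k2 h0 h1; have e0 := last_edge_joins h h0.
have e1 := last_edge_joins h h1.
rewrite -(complexity_glue k2 e1); congr (_ + _).
rewrite /= (glue_edge_side _ (polygon_edge_side h1)).
by rewrite (trees_without_side k1 e0).
Qed.

Lemma CS_chain_take k h m l : m < l ->
  CS_chain (take l k) (take l h) m = CS_chain k h m.
Proof.
elim: m => [|m IHm] ml /=; first by rewrite nth_take.
by rewrite IHm ?nth_take //; lia.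
Qed.

Local Open Scope ring_scope.

Theorem proposition2p7 (n : nat) (hn : (3 <= n)%N) (k h : n.-tuple nat)
    (hk : forall i : 'I_n, (1 < tnth k i)%N)
    (hh : forall i : 'I_n, (0 < tnth h i < tnth k i)%N) :
  (complexity (CS k h))%:Z =
    (nth 0%N k n.-1)%:Z * (complexity (CS (take n.-1 k) (take n.-1 h)))%:Z
    - (complexity (CS (take n.-2 k) (take n.-2 h)))%:Z.
Proof.
have hk' i : (i < n)%N -> (1 < nth 0%N k i)%N.
  by move=> i_n; have := hk (Ordinal i_n); rewrite (tnth_nth 0%N).
have hh' i : (i < n)%N -> (0 < nth 0%N h i < nth 0%N k i)%N.
  by move=> i_n; have := hh (Ordinal i_n); rewrite !(tnth_nth 0%N).
rewrite /CS !size_takel ?size_tuple; [|lia..].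
rewrite !CS_chain_take; [|lia..].
case: n hn k h hk hh hk' hh' => [|[|[|m]]] // hn k h _ _ hk hh /=.
have := @CS_chain_recurrence k h m (hk _ _) (hk _ _) (hh _ _) (hh _ _).
move=> /(_ _ _ _ _)/= E; lia.
Qed.
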